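(* Let $F_2$ be the free group of rank $2$. The set of primitive elements of $F_2$ is closed in the profinite topology on $F_2$.
   Context: An element of a free group is primitive if it belongs to some basis (free generating set). The profinite topology on a group is the topology for which the cosets of finite-index normal subgroups form a basis of open sets. *)

(* Defs.v *)
From HB Require Import structures.
From mathcomp Require Import all_boot.
From mathcomp Require Import all_classical topology.

Set Implicit Arguments.
Unset Strict Implicit.
Unset Printing Implicit Defensive.

Local Open Scope group_scope.
Local Open Scope classical_set_scope.

(* Universal property; only the values of f on B matter. *)
Definition free_basis (G : groupType) (B : set G) : Prop :=
  forall (H : groupType) (f : G -> H),
    exists! phi : G -> H,
      monoid_morphism phi /\ (forall b, B b -> phi b = f b).

Definition free_of_rank (n : nat) (G : groupType) : Prop :=
  exists2 B : set G, free_basis B & (B #= `I_n)%card.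

Definition primitive (G : groupType) (x : G) : Prop :=
  exists2 B : set G, free_basis B & B x.

Definition coset (G : groupType) (N : set G) (x : G) : set G :=
  [set x * n | n in N].

Record normal_subgroup (G : groupType) (N : set G) : Prop := NormalSubgroup {
  normal_subgroup1 : N 1;
  normal_subgroupM : forall x y, N x -> N y -> N (x * y);
  normal_subgroupV : forall x, N x -> N x^-1;
  normal_subgroupJ : forall x g, N x -> N (x ^ g)
}.

Definition finite_index (G : groupType) (N : set G) : Prop :=
  finite_set (range (coset N)).

Definition profinite_base (G : groupType) : set (set G) :=
  [set U | exists N x,
     [/\ normal_subgroup N, finite_index N & U = coset N x]].

Arguments profinite_base : clear implicits.

Section ProfiniteBase.
Variable G : groupType.
Implicit Types (N M : set G) (x y t : G).

Lemma mem_coset N x t : coset N x t <-> N (x^-1 * t).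
Proof.
by split=> [[n Nn <-]|Nt]; [rewrite mulKg|exists (x^-1 * t); rewrite ?mulVKg].
Qed.

Lemma cosetI N M x : coset (N `&` M) x = coset N x `&` coset M x.
Proof. by apply/seteqP; split=> t; rewrite /setI/= !mem_coset. Qed.

Lemma coset_eq N x t : normal_subgroup N -> coset N x t -> coset N x = coset N t.
Proof.
move=> nN /mem_coset Nxt; apply/seteqP; split=> z /mem_coset Nz; apply/mem_coset.
  have -> : t^-1 * z = (x^-1 * t)^-1 * (x^-1 * z).
    by rewrite invgM invgK -!mulgA mulVKg.
  by apply: normal_subgroupM => //; exact: normal_subgroupV.
have -> : x^-1 * z = (x^-1 * t) * (t^-1 * z) by rewrite -!mulgA mulVKg.
exact: normal_subgroupM.
Qed.

Lemma normal_subgroupI N M :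
  normal_subgroup N -> normal_subgroup M -> normal_subgroup (N `&` M).
Proof.
move=> [N1 NM NV NJ] [M1 MM MV MJ]; split=> //.
- by move=> x y [? ?] [? ?]; split; [exact: NM|exact: MM].
- by move=> x [? ?]; split; [exact: NV|exact: MV].
- by move=> x g [? ?]; split; [exact: NJ|exact: MJ].
Qed.

Lemma finite_indexI N M :
  finite_index N -> finite_index M -> finite_index (N `&` M).
Proof.
move=> fN fM.
apply: (sub_finite_set _ (finite_image (fun U => U.1 `&` U.2)
  (finite_setX fN fM))).
move=> _ [x _ <-]; exists (coset N x, coset M x); last by rewrite cosetI.
by split=> /=; exists x.
Qed.

Lemma profinite_base_cover : \bigcup_(U in profinite_base G) U = setT.
Proof.
apply/seteqP; split=> // t _; exists (coset setT t).
  exists setT, t; split=> //.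
  apply: (@sub_finite_set _ _ [set setT]) => //.
  move=> _ [x _ <-] /=; apply/seteqP; split=> // z _; exact/mem_coset.
by apply/mem_coset.
Qed.

Lemma profinite_base_join (U V : set G) t :
  profinite_base G U -> profinite_base G V -> U t -> V t ->
  exists W, [/\ profinite_base G W, W t & W `<=` U `&` V].
Proof.
move=> [N [x [nN fN ->]]] [M [y [nM fM ->]]] xt yt.
exists (coset (N `&` M) t); split.
- exists (N `&` M), t; split=> //; first exact: normal_subgroupI.
  exact: finite_indexI.
- apply/mem_coset; rewrite mulVg.
  by split; apply: normal_subgroup1.
- by rewrite cosetI (coset_eq nN xt) (coset_eq nM yt).
Qed.

End ProfiniteBase.

(* Alias of G carrying the profinite topology. *)
Definition profinite (G : groupType) : Type := G.

HB.instance Definition _ (G : groupType) := Group.on (profinite G).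
HB.instance Definition _ (G : groupType) :=
  @isBaseTopological.Build (profinite G) (set G) (profinite_base G) id
    (@profinite_base_cover G) (@profinite_base_join G).

(* Main.v *)
(** The argument is a linear form of Stallings' ends together with Whitehead's
algorithm.  Fix a finite field [k].  Say that [w] is split by [h : F -> k] when
[h] has finite coboundary on the Cayley tree and [h (g w) <> h g] exactly for
[g = 1].

If [w] is in the profinite closure of the primitive elements then [w] is split.
Otherwise the indicator of [1] is not of the form [g |-> h (g w) - h g]; modulo
functions of that form, the prefixes of [w] span a finite-dimensional space with
a nonzero vector [v], on which the generators act by partial isomorphisms.
Extending these to invertible matrices (as in M. Hall's theorem) gives a
representation [rho] of [F] over [k] for which [v *m d w = 0] for every
derivation [d : F -> k^n].  But [w] agrees with some basis element [u] in all
homomorphisms to the finite affine group [GL_n(k) |x k^n], and a derivation may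
take any value at [u].

Conversely let [w] be split, and choose a basis for which the cyclically reduced
form of [w] is shortest.  If its length is at least 2, minimality under Nielsen
moves forces the Whitehead graph of [w] on the four letters to contain a
Hamiltonian cycle, unless [w] is a proper power.  As [h] takes the same value at
both ends of every translate of the axis of [w] except the axis itself, a
descending induction on spheres of the tree shows that [h] is constant at
infinity, contradicting [h w <> h 1]. *)

From HB Require Import structures.
Require Import Defs.
From mathcomp Require Import all_boot all_order fingroup all_algebra.
From mathcomp Require Import all_classical topology.
From mathcomp Require Import zify.

Set Implicit Arguments.
Unset Strict Implicit.
Unset Printing Implicit Defensive.

Local Open Scope group_scope.

(** * Free pairs, reduced words and normal forms *)

Section Morphisms.
Variables (G H : groupType) (f : G -> H).
Hypothesis f_morph : monoid_morphism f.

Lemma morph_one : f 1 = 1. Proof. by case: f_morph. Qed.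
Lemma morph_mul : {morph f : x y / x * y}. Proof. by case: f_morph. Qed.
Lemma morph_inv : {morph f : x / x^-1}.
Proof. by move=> x; apply: (mulgI (f x)); rewrite -morph_mul !mulgV morph_one. Qed.
End Morphisms.

(** An ordered basis of rank two: a morphism is prescribed by two values rather than by a function
    on [F]. *)
Definition free_pair (F : groupType) (a b : F) : Prop :=
  forall (H : groupType) (x y : H),
    exists! phi : F -> H, monoid_morphism phi /\ (phi a = x /\ phi b = y).

(** The first component selects the generator, the second marks its inverse. *)
Definition letter : Type := bool * bool.

Definition flip (x : letter) : letter := (x.1, ~~ x.2).

Lemma flipK : involutive flip. Proof. by case=> c e; rewrite /flip negbK. Qed.

Lemma flip_neq x : (x == flip x) = false. Proof. by case: x => -[] []. Qed.

Definition reduced : pred (seq letter) := sorted (fun x y => y != flip x).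

Definition push (x : letter) (t : seq letter) : seq letter :=
  if t is y :: t' then if y == flip x then t' else x :: t else [:: x].

Lemma reduced_cons x t :
  reduced (x :: t) = (ohead t != Some (flip x)) && reduced t.
Proof. by case: t => [|y t]. Qed.

Lemma reduced_behead t : reduced t -> reduced (behead t).
Proof. by case: t => // x t; rewrite reduced_cons => /andP[]. Qed.

Lemma reduced_push x t : reduced t -> reduced (push x t).
Proof.
case: t => // y t rt /=; case: eqVneq => [_|yx]; first exact: reduced_behead rt.
by rewrite reduced_cons rt andbT; apply: contraNneq yx => -[->].
Qed.

Lemma pushK x t : reduced t -> push (flip x) (push x t) = t.
Proof.
case: t => [|y t] rt; first by rewrite /= flipK eqxx.
rewrite /=; case: eqVneq => [yx|_]; last by rewrite /= flipK eqxx.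
case: t rt => [|z t] rt /=; first by rewrite yx.
by move: rt; rewrite yx /= flipK => /andP[/negPf-> _].
Qed.

Lemma push_reduced x t : reduced (x :: t) -> push x t = x :: t.
Proof. by case: t => //= y t /andP[/negPf->]. Qed.

Arguments reduced : simpl never.

Section Words.
Variables (F : groupType) (a b : F).

Definition ev (x : letter) : F :=
  let g := if x.1 then b else a in if x.2 then g^-1 else g.

Lemma ev_flip x : ev (flip x) = (ev x)^-1.
Proof. by case: x => -[] [] /=; rewrite /ev /= ?invgK. Qed.

Arguments ev : simpl never.

(* Words are read from right to left: the head of the list is the last
   letter. *)
Definition evr (t : seq letter) : F := foldr (fun x g => g * ev x) 1 t.

Lemma evr_cat r t : evr (r ++ t) = evr t * evr r.
Proof. by elim: r => [|x r IH] /=; rewrite ?mulg1 // IH mulgA. Qed.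

Lemma evr_push x t : evr (push x t) = evr t * ev x.
Proof.
case: t => //= y t; case: eqVneq => [->|//].
by rewrite ev_flip mulgVK.
Qed.

Definition rword : Type := {t : seq letter | reduced t}.

Definition rpush x (t : rword) : rword := Sub (push x (val t)) (reduced_push x (valP t)).

Lemma rpushK x : cancel (rpush x) (rpush (flip x)).
Proof. by move=> t; apply: val_inj; apply: pushK; apply: valP. Qed.

Lemma rpushVK x : cancel (rpush (flip x)) (rpush x).
Proof. by move=> t; rewrite -{1}[x]flipK rpushK. Qed.

(* Bijections of the reduced words that act as right multiplication by a given
   element of [F].  The universal property maps [F] to this group, which yields
   both the existence and the uniqueness of normal forms. *)
Record walk : Type := Walk {
  wfun : rword -> rword;
  winv : rword -> rword;
  wlab : F;
  wfunK : cancel wfun winv;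
  winvK : cancel winv wfun;
  wfunE : forall t, evr (val (wfun t)) = evr (val t) * wlab
}.

HB.instance Definition _ := gen_eqMixin walk.
HB.instance Definition _ := gen_choiceMixin walk.

Lemma walk_eq (u v : walk) : wfun u = wfun v -> wlab u = wlab v -> u = v.
Proof.
case: u v => [f f' g fK f'K fE] [h h' k hK h'K hE] /= fh gk.
rewrite -{}fh -{}gk in hK h'K hE *.
have f'h' : f' = h' by apply/funext => t; rewrite -{1}[t]h'K fK.
rewrite -{}f'h' in hK h'K *.
by rewrite (Prop_irrelevance fK hK) (Prop_irrelevance f'K h'K) (Prop_irrelevance fE hE).
Qed.

Definition walk_one : walk :=
  @Walk id id 1 (fun=> erefl) (fun=> erefl) (fun t => esym (mulg1 _)).

Fact walk_mulE (u v : walk) t :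
  evr (val (wfun v (wfun u t))) = evr (val t) * (wlab u * wlab v).
Proof. by rewrite !wfunE mulgA. Qed.

Definition walk_mul (u v : walk) : walk :=
  @Walk (wfun v \o wfun u) (winv u \o winv v) (wlab u * wlab v)
    (can_comp (wfunK v) (wfunK u)) (can_comp (winvK u) (winvK v))
    (walk_mulE u v).

Fact walk_invE (u : walk) t : evr (val (winv u t)) = evr (val t) * (wlab u)^-1.
Proof. by rewrite -{2}[t](winvK u) wfunE mulgK. Qed.

Definition walk_inv (u : walk) : walk :=
  @Walk (winv u) (wfun u) (wlab u)^-1 (winvK u) (wfunK u) (walk_invE u).

Fact walk_mulA : associative walk_mul.
Proof. by move=> u v s; apply: walk_eq => //=; rewrite mulgA. Qed.
Fact walk_mul1 : left_id walk_one walk_mul.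
Proof. by move=> u; apply: walk_eq => //=; rewrite mul1g. Qed.
Fact walk_mulr1 : right_id walk_one walk_mul.
Proof. by move=> u; apply: walk_eq => //=; rewrite mulg1. Qed.
Fact walk_mulV : left_inverse walk_one walk_inv walk_mul.
Proof.
move=> u; apply: walk_eq => /=; last by rewrite mulVg.
by apply/funext => t /=; rewrite winvK.
Qed.
Fact walk_mulrV : right_inverse walk_one walk_inv walk_mul.
Proof.
move=> u; apply: walk_eq => /=; last by rewrite mulgV.
by apply/funext => t /=; rewrite wfunK.
Qed.

HB.instance Definition _ := isGroup.Build walk
  walk_mulA walk_mul1 walk_mulr1 walk_mulV walk_mulrV.

Definition walk_letter (x : letter) : walk :=
  @Walk (rpush x) (rpush (flip x)) (ev x) (rpushK x) (rpushVK x)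
    (fun t => evr_push x (val t)).

Lemma walk_letter_flip x : walk_letter (flip x) = (walk_letter x)^-1.
Proof. by apply: walk_eq; rewrite //= ev_flip. Qed.

Hypothesis ab_free : free_pair a b.

Lemma free_pair_id (f : F -> F) :
  monoid_morphism f -> f a = a -> f b = b -> f = id.
Proof.
move=> fM fa fb; have [g [_ gU]] := ab_free a b.
by rewrite -(gU f) ?(gU id).
Qed.

Lemma normal_form_exists : exists nf : F -> seq letter,
  [/\ forall g, reduced (nf g), nf 1 = [::],
      forall g, evr (nf g) = g & forall g x, nf (g * ev x) = push x (nf g)].
Proof.
have [phi [[phiM [phia phib]] _]] :=
  ab_free (walk_letter (false, false)) (walk_letter (true, false)).
have phi_ev x : phi (ev x) = walk_letter x.
  by case: x => -[] []; rewrite /ev /= ?(morph_inv phiM) ?phia ?phib //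
    -walk_letter_flip.
(* The labels give an endomorphism of [F] that fixes the basis; hence the walk of [g] takes the
   empty word to a word with value [g]. *)
have lab_id : wlab \o phi = id.
  apply: free_pair_id; rewrite /= ?phia ?phib //.
  by split=> [|x y] /=; rewrite ?(morph_one phiM) ?(morph_mul phiM).
pose e : rword := Sub [::] isT.
exists (fun g => val (wfun (phi g) e)); split=> [g||g|g x].
- exact: valP.
- by rewrite (morph_one phiM).
- rewrite wfunE mul1g; exact: (congr1 (@^~ g) lab_id).
- by rewrite (morph_mul phiM) phi_ev.
Qed.

Definition nf : F -> seq letter := projT1 (cid normal_form_exists).

Lemma nf1 : nf 1 = [::].
Proof. by rewrite /nf; case: cid => /= f []. Qed.
Lemma nfK g : evr (nf g) = g.
Proof. by rewrite /nf; case: cid => /= f []. Qed.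
Lemma nf_mul_ev g x : nf (g * ev x) = push x (nf g).
Proof. by rewrite /nf; case: cid => /= f []. Qed.

Lemma evrK t : reduced t -> nf (evr t) = t.
Proof.
elim: t => [|x t IH] rt; first exact: nf1.
by rewrite /= nf_mul_ev IH ?push_reduced //; apply: reduced_behead rt.
Qed.

Lemma nf_eq1 g : (nf g == [::]) = (g == 1).
Proof.
by apply/eqP/eqP => [g1|->]; [rewrite -[g]nfK g1|rewrite nf1].
Qed.

End Words.

(** * Almost invariant functions and half-trees *)

Section AlmostInvariant.
Variables (F : groupType) (T : eqType).
Implicit Type h : F -> T.

Definition almost_invariant h : Prop :=
  forall x, finite_set [set g | h (g * x) != h g]%classic.

Lemma finite_translate (A : set F) x :
  finite_set A -> finite_set [set g | A (g * x)]%classic.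
Proof.
move=> fA; apply: (sub_finite_set _ (finite_image (fun g => g * x^-1) fA)).
by move=> g /= Agx; exists (g * x); rewrite ?mulgK.
Qed.

Lemma almost_invariantP a b h : free_pair a b ->
  (forall c, finite_set [set g | h (g * ev a b (c, false)) != h g]%classic) ->
  almost_invariant h.
Proof.
move=> ab hc x; rewrite -[x](nfK ab).
elim: (nf ab x) => [|y t IH] /=.
  by apply: (sub_finite_set _ (finite_set0 F)) => g /=; rewrite mulg1 eqxx.
have {}hc : finite_set [set g | h (g * ev a b y) != h g]%classic.
  case: y => c -[]; last exact: hc.
  apply: (sub_finite_set _ (finite_translate (ev a b (c, true)) (hc c))) => g /=.
  by rewrite [(c, true)]/(flip (c, false)) ev_flip mulgVK eq_sym.
have fU : finite_set ([set g | h (g * evr a b t) != h g] `|`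
    [set g | [set g' | h (g' * ev a b y) != h g'] (g * evr a b t)])%classic.
  by rewrite finite_setU; split=> //; apply: finite_translate.
apply: (sub_finite_set _ fU) => g /= ne; rewrite mulgA in ne.
by case: (eqVneq (h (g * evr a b t)) (h g)) ne => [<- ?|? _]; [right|left].
Qed.

End AlmostInvariant.

Section HalfTree.
Variables (F : groupType) (a b : F) (ab : free_pair a b) (k : nzRingType).
Import GRing.Theory.
Local Open Scope ring_scope.

(** The last entry of the list is the first letter of the word, so this is the indicator of the
    half-tree beyond the edge from [1] to the generator [c]. The default [(c, true)] leaves the root
    outside. *)
Definition half_tree (c : bool) (g : F) : k :=
  (last (c, true) (nf ab g) == (c, false))%:R.

Lemma half_treeD c d g : half_tree c (g * ev a b (d, false))%g - half_tree c g =
  ((d == c) && (g == 1%g))%:R.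
Proof.
rewrite /half_tree nf_mul_ev -(nf_eq1 ab).
case: (nf ab g) => [|[e f] [|z t]] /=.
- by rewrite !xpair_eqE eqxx !andbF !andbT subr0.
- by case: c d e f => -[] [] [] /=; rewrite subrr.
- by case: ifP; rewrite /= andbF subrr.
Qed.

Lemma half_treeDV c d g : half_tree c (g * ev a b (d, true))%g - half_tree c g =
  - ((d == c) && (g * ev a b (d, true) == 1)%g)%:R.
Proof.
rewrite -half_treeD [(d, true)]/(flip (d, false)) (ev_flip _ _ (d, false)).
by rewrite mulgVK opprB.
Qed.

Lemma half_tree_almost_invariant c : almost_invariant (half_tree c).
Proof.
apply: (almost_invariantP ab) => d.
apply: (sub_finite_set _ (finite_set1 1%g)) => g /=.
by rewrite -subr_eq0 half_treeD; case: (eqVneq g 1%g) => // _; rewrite andbF eqxx.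
Qed.

End HalfTree.

(** * Paths in the Cayley tree *)

Section Path.
Variables (F : groupType) (a b : F) (y : nat -> letter).

(** Paths read their letters from left to right, unlike [evr]; indexing the letters by [nat]
    accommodates periodic words. *)
Fixpoint pth (n : nat) : F := if n is m.+1 then pth m * ev a b (y m) else 1.

End Path.

Lemma eq_pth (F : groupType) (a b : F) (y z : nat -> letter) n :
  (forall i, i < n -> y i = z i) -> pth a b y n = pth a b z n.
Proof.
by elim: n => //= n IH yz; rewrite yz ?IH // => i /ltnW in_n; apply: yz.
Qed.

Lemma evr_pth (F : groupType) (a b : F) t : exists y, pth a b y (size t) = evr a b t.
Proof.
elim: t => [|x t [y yt]]; first by exists (fun=> (false, false)).
exists (fun i => if i < size t then y i else x); rewrite /= ltnn -yt.
by congr (_ * _); apply: eq_pth => i ->.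
Qed.

Lemma path_exists (F : groupType) (a b : F) (ab : free_pair a b) (g : F) :
  exists y n, pth a b y n = g.
Proof.
have [y yg] := evr_pth a b (nf ab g).
by exists y, (size (nf ab g)); rewrite yg nfK.
Qed.

(** * A linear representation built from the prefixes of a word *)

Section Unitmx.
Import GRing.Theory.
Local Open Scope ring_scope.

(** The rows of [A] and of [B] satisfy the same linear relations, so matching them is an isomorphism
    of row spaces, which extends to the whole space. In the proof this appears as equality of the
    column spaces. *)
Lemma unitmx_extension (k : fieldType) (m n : nat) (A B : 'M[k]_(m, n)) :
  (forall v : 'rV_m, v *m A = 0 <-> v *m B = 0) ->
  exists2 P : 'M_n, P \in unitmx & A *m P = B.
Proof.
have subT (C D : 'M[k]_(m, n)) :
    (forall v : 'rV_m, v *m C = 0 -> v *m D = 0) -> (D^T <= C^T)%MS.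
  move=> CD; rewrite submxE -trmx_eq0 trmx_mul trmxK; apply/eqP/row_matrixP => i.
  rewrite row_mul row0; apply: CD.
  rewrite -row_mul; have /(congr1 trmx) := mulmx_coker C^T.
  by rewrite trmx_mul trmxK trmx0 => ->; rewrite row0.
move=> AB; have: (B^T == A^T)%MS by apply/andP; split; apply: subT => v /AB.
case/eqmxMunitP=> P Pu BP; exists P^T; first by rewrite unitmx_tr.
by rewrite -[B]trmxK BP trmx_mul trmxK.
Qed.

End Unitmx.

Section LinearHall.
Variables (F : groupType) (a b : F) (ab : free_pair a b) (k : finFieldType).
Variables (y : nat -> letter) (L : nat).
Import GRing.Theory.
Local Open Scope ring_scope.
Local Notation n := L.+1.
Local Notation p := (pth a b y).
Local Notation w := (p L).
Implicit Types (c : 'rV[k]_n) (h : F -> k).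

(** A prefix is recorded by the indicator of its inverse: appending a letter then becomes a left
    translation, which commutes with [h (g * w) - h g]. *)
Definition mark c (g : F) : k := \sum_i c 0 i *+ (g * p i == 1)%g.

(* The relations [c] among the prefixes of [w] hold modulo the functions
   [g |-> h (g w) - h g]. *)
Definition coboundary c : Prop :=
  exists2 h, almost_invariant h & forall g, h (g * w)%g - h g = mark c g.

Lemma mark_linear (x : k) c d g : mark (x *: c + d) g = x * mark c g + mark d g.
Proof.
rewrite /mark big_distrr -big_split; apply: eq_bigr => i _ /=.
by rewrite !mxE mulrnAr mulrnDl.
Qed.

Lemma coboundary0 : coboundary 0.
Proof.
exists (fun=> 0) => [x|g]; last first.
  by rewrite subrr /mark big1 // => i _; rewrite mxE mul0rn.
by apply: (sub_finite_set _ (finite_set0 F)) => g /=; rewrite eqxx.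
Qed.

Lemma coboundary_linear (x : k) c d :
  coboundary c -> coboundary d -> coboundary (x *: c + d).
Proof.
move=> [h hA hc] [h' hA' hd]; exists (fun g => x * h g + h' g) => [z|g].
  have fU : finite_set ([set g | h (g * z)%g != h g] `|`
      [set g | h' (g * z)%g != h' g])%classic by rewrite finite_setU.
  apply: (sub_finite_set _ fU) => g /=.
  case: (eqVneq (h (g * z)%g) (h g)) => [->|? _]; last by left.
  by case: (eqVneq (h' (g * z)%g) (h' g)) => [->|]; [rewrite eqxx|right].
by rewrite mark_linear -hc -hd mulrBr opprD addrACA.
Qed.

(** As [k] is finite, the subspace of relations is the finite sum of the lines through its
    elements. *)
Definition coboundary_mx : 'M[k]_n := (\sum_(c | `[< coboundary c >]) <<c>>)%MS.

Lemma coboundary_mxP c : reflect (coboundary c) (c <= coboundary_mx)%MS.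
Proof.
apply: (iffP idP) => [/sub_sumsmxP[u ->]|cc]; last first.
  by rewrite (sumsmx_sup c) ?genmxE //; apply/asboolP.
apply: (big_ind coboundary) => [|c1 c2 h1 h2|d /asboolP dc].
- exact: coboundary0.
- by rewrite -[c1]scale1r; apply: coboundary_linear.
- have: (u d *m <<d>> <= d)%MS by rewrite -(genmxE d) submxMl.
  case/sub_rVP=> x ->; rewrite -[_ *: _]addr0.
  exact: coboundary_linear dc coboundary0.
Qed.

(** Row [i] represents the class of the [i]-th prefix modulo the relations. *)
Definition relmx : 'M[k]_n := cokermx coboundary_mx.

Lemma relmxP c : c *m relmx = 0 <-> coboundary c.
Proof.
by split=> [cM|/coboundary_mxP]; [apply/coboundary_mxP; rewrite submxE cM|rewrite submxE => /eqP].
Qed.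

(* The [i]-th step of the path is an edge labelled by a generator, traversed
   backwards when the letter is an inverse. *)
Definition src (i : nat) : nat := if (y i).2 then i.+1 else i.
Definition tgt (i : nat) : nat := if (y i).2 then i else i.+1.

Lemma src_lt (i : 'I_L) : (src i < n)%N.
Proof. by rewrite /src; case: ifP => _; rewrite ltnS // ltnW. Qed.
Lemma tgt_lt (i : 'I_L) : (tgt i < n)%N.
Proof. by rewrite /tgt; case: ifP => _; rewrite ltnS // ltnW. Qed.

Definition osrc (i : 'I_L) : 'I_n := Ordinal (src_lt i).
Definition otgt (i : 'I_L) : 'I_n := Ordinal (tgt_lt i).

Lemma pth_tgt i : p (tgt i) = (p (src i) * ev a b ((y i).1, false))%g.
Proof.
rewrite /tgt /src; case E: (y i) => [c []] /=; rewrite E //=.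
by rewrite -[ev a b (c, true)]/(ev a b (flip (c, false))) ev_flip mulgVK.
Qed.

Definition selmx (e : 'I_L -> 'I_n) (q : bool) : 'M[k]_(L, n) :=
  \matrix_(i, j) (((y i).1 == q) && (j == e i))%:R.

Lemma mark_sel e q (v : 'rV_L) g : mark (v *m selmx e q) g =
  \sum_(i < L | (y i).1 == q) v 0 i *+ (g * p (e i) == 1)%g.
Proof.
rewrite /mark; under eq_bigr => j _ do rewrite mxE -sumrMnl.
rewrite exchange_big [RHS]big_mkcond; apply: eq_bigr => i _ /=.
rewrite (bigD1 (e i)) //= big1 => [|j /negPf ji]; last first.
  by rewrite !mxE ji andbF mulr0 mul0rn.
rewrite !mxE eqxx andbT addr0.
by case: ifP => _; rewrite ?mulr1 // mulr0 mul0rn.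
Qed.

(** Left translation by the generator matches the sources of its edges with their targets, and it
    preserves almost invariance. *)
Lemma coboundary_sel q (v : 'rV_L) :
  coboundary (v *m selmx osrc q) <-> coboundary (v *m selmx otgt q).
Proof.
pose x := ev a b (q, false).
have shift z (d d' : 'rV_n) : (forall g, mark d' g = mark d (z * g)%g) ->
    coboundary d -> coboundary d'.
  move=> dd' [h hA hd]; exists (fun g => h (z * g)%g) => [u|g]; last first.
    by rewrite dd' -hd mulgA.
  apply: (sub_finite_set _ (finite_image (fun g => z^-1 * g)%g (hA u))) => g /=.
  by rewrite mulgA => ne; exists (z * g)%g; rewrite ?mulKg.
have markE g : mark (v *m selmx otgt q) g = mark (v *m selmx osrc q) (x * g)%g.
  rewrite !mark_sel; apply: eq_bigr => i /eqP yq; congr (_ *+ _).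
  rewrite /= pth_tgt yq -/x mulgA -[in RHS]mulgA.
  by rewrite (mulg_eq1 x) -eqg_invLR mulg_eq1 eq_sym.
split; first exact: shift.
apply: (shift x^-1%g) => g; by rewrite markE mulVKg.
Qed.

Definition relrow (i : nat) : 'rV[k]_n := row (inord i) relmx.

Lemma mul_selmx e q (i : 'I_L) : (y i).1 = q ->
  row i (selmx e q *m relmx) = relrow (e i).
Proof.
move=> yq; rewrite row_mul /relrow inord_val [RHS]rowE; congr (_ *m _).
by apply/rowP => j; rewrite !mxE yq eqxx eq_sym.
Qed.

Lemma partial_iso q : exists P : {'GL_n[k]}, forall i : 'I_L, (y i).1 = q ->
  relrow (src i) *m GLval P = relrow (tgt i).
Proof.
have [|P Pu PE] := @unitmx_extension k L n (selmx osrc q *m relmx) (selmx otgt q *m relmx).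
  move=> v; rewrite (mulmxA v (selmx osrc q)) (mulmxA v (selmx otgt q)).
  exact: (iff_trans (relmxP _) (iff_trans (coboundary_sel q v) (iff_sym (relmxP _)))).
exists (Sub P Pu) => i yq /=.
by rewrite -(mul_selmx osrc yq) -(mul_selmx otgt yq) -PE !row_mul.
Qed.

Definition representation (rho : F -> {'GL_n[k]}) : Prop :=
  monoid.monoid_morphism rho /\
  forall i, (i <= L)%N -> relrow 0 *m GLval (rho (p i)) = relrow i.

Lemma representation_exists : exists rho, representation rho.
Proof.
have [P PE] := partial_iso false; have [Q QE] := partial_iso true.
have [rho [[rhoM [rho_a rho_b]] _]] := ab P Q; exists rho; split=> //.
have rhoE (i : 'I_L) :
    relrow (src i) *m GLval (rho (ev a b ((y i).1, false))) = relrow (tgt i).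
  by case yi: (y i).1; rewrite /ev /= ?rho_a ?rho_b; [apply: QE|apply: PE].
elim=> [|i IH] iL; first by rewrite /= (morph_one rhoM) GL_1E mulmx1.
rewrite /= (morph_mul rhoM) GL_MxE mulmxA IH ?(ltnW iL) //.
have := rhoE (Ordinal iL); rewrite /src /tgt /=.
case: (y i) => c [] //= <-.
rewrite -[ev a b (c, true)]/(ev a b (flip (c, false))) ev_flip.
by rewrite (morph_inv rhoM) GL_VxE mulmxK //; apply: (valP (rho _)).
Qed.

Definition edge_sign (i : nat) : k := if (y i).2 then -1 else 1.

(* The half-tree of a generator [q] has a single [q]-edge in its boundary; its
   coboundary along [w] therefore counts the [q]-edges of the path. *)
Lemma edges_coboundary q :
  \sum_(i < L | (y i).1 == q) edge_sign i *: relrow (src i) = 0.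
Proof.
pose v : 'rV[k]_L := \row_i (edge_sign i *+ ((y i).1 == q)).
have vc : coboundary (v *m selmx osrc q).
  exists (half_tree ab k q) => [|g]; first exact: half_tree_almost_invariant.
  have -> m : half_tree ab k q (g * p m)%g - half_tree ab k q g =
      \sum_(i < m | (y i).1 == q) edge_sign i *+ (g * p (src i) == 1)%g.
    elim: m => [|m IH]; first by rewrite big_ord0 mulg1 subrr.
    rewrite big_mkcond big_ord_recr -big_mkcond -IH /= /edge_sign /src.
    rewrite mulgA -(subrKA (half_tree ab k q (g * p m)%g)) addrC; congr (_ + _).
    case ym: (y m) => [c []] /=; rewrite ?ym ?half_treeDV ?half_treeD; case: (c == q) => //=.
      by rewrite mulgA mulNrn.
    by rewrite oppr0.
  rewrite mark_sel; apply: eq_bigr => i yq; by rewrite mxE yq.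
move/relmxP: vc; rewrite -mulmxA mulmx_sum_row => vc; apply: etrans vc.
rewrite [LHS]big_mkcond; apply: eq_bigr => i _; rewrite mxE.
case: eqVneq => [yq|_]; last by rewrite mulr0n scale0r.
by rewrite -(mul_selmx osrc yq) rowE.
Qed.

End LinearHall.

(** * Affine groups and finite quotients *)

Section AffineGroup.
Variables (k : finFieldType) (n : nat).
Import GRing.Theory.
Local Open Scope ring_scope.

(** A morphism to this semidirect product is a representation together with a derivation. The size
    [n.-1.+1] is that of the matrices in [{'GL_n[k]}]. *)
Definition affine : Type := ({'GL_n[k]} * 'cV[k]_n.-1.+1)%type.

HB.instance Definition _ := Finite.on affine.

Implicit Types u v : affine.

Definition affine_mul u v : affine := ((u.1 * v.1)%g, u.2 + GLval u.1 *m v.2).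
Definition affine_one : affine := (1%g, 0).
Definition affine_inv u : affine := (u.1^-1%g, - (GLval u.1^-1%g *m u.2)).

Fact affine_mulA : associative affine_mul.
Proof.
move=> u v t; rewrite /affine_mul /= mulgA; congr pair.
by rewrite mulmxDr addrA mulmxA.
Qed.
Fact affine_mul1 : left_id affine_one affine_mul.
Proof. by case=> P c; rewrite /affine_mul /= mul1g mul1mx add0r. Qed.
Fact affine_mulr1 : right_id affine_one affine_mul.
Proof. by case=> P c; rewrite /affine_mul /= mulg1 mulmx0 addr0. Qed.
Fact affine_mulV : left_inverse affine_one affine_inv affine_mul.
Proof. by case=> P c; rewrite /affine_mul /= mulVg addNr. Qed.
Fact affine_mulrV : right_inverse affine_one affine_inv affine_mul.
Proof.
case=> P c; rewrite /affine_mul /= mulgV mulmxN mulmxA mulmxV ?mul1mx ?subrr //.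
exact: (valP P).
Qed.

HB.instance Definition _ := isGroup.Build affine
  affine_mulA affine_mul1 affine_mulr1 affine_mulV affine_mulrV.

End AffineGroup.

Lemma open_coset (G : groupType) (N : set G) x :
  normal_subgroup N -> finite_index N -> open (coset N x : set (profinite G)).
Proof.
move=> nN fN; exists [set coset N x]%classic; first by move=> _ ->; exists N, x.
by rewrite bigcup_set1.
Qed.

(** A morphism is determined by its values at [a] and [b], so there are finitely many, and the table
    of their values at [g] determines the coset of [g]. *)
Lemma kernels_finite_index (F : groupType) (a b : F) (H : finGroupType) :
  free_pair a b ->
  let N := [set g : F | forall f : F -> H, monoid.monoid_morphism f -> f g = 1]%classic in
  normal_subgroup N /\ finite_index N.
Proof.
move=> ab N; split.
  split=> [f fM|x y Nx Ny f fM|x Nx f fM|x g Nx f fM]; rewrite ?(morph_one fM) //.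
  - by rewrite (morph_mul fM) Nx ?Ny ?mulg1.
  - by rewrite (morph_inv fM) Nx ?invg1.
  - by rewrite conjgE !(morph_mul fM) Nx // mul1g -(morph_mul fM) mulVg (morph_one fM).
pose f (xy : H * H) := projT1 (cid (ab H xy.1 xy.2)).
have fP xy : monoid.monoid_morphism (f xy).
  by rewrite /f; case: cid => g [[]].
have fU (g : F -> H) : monoid.monoid_morphism g -> g = f (g a, g b).
  by move=> gM; rewrite /f; case: cid => g' /= [_ gU]; apply/esym/gU.
pose r g : {ffun H * H -> H} := [ffun xy => f xy g].
have rN x y : r x = r y -> coset N x = coset N y.
  move=> /ffunP rxy; apply: coset_eq; last first.
    apply/mem_coset => g gM; rewrite (fU _ gM) (morph_mul (fP _)) (morph_inv (fP _)).
    by have := rxy (g a, g b); rewrite !ffunE => ->; rewrite mulVg.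
  split=> [g gM|z t Nz Nt g gM|z Nz g gM|z t Nz g gM]; rewrite ?(morph_one gM) //.
  - by rewrite (morph_mul gM) Nz ?Nt ?mulg1.
  - by rewrite (morph_inv gM) Nz ?invg1.
  - by rewrite conjgE !(morph_mul gM) Nz // mul1g -(morph_mul gM) mulVg (morph_one gM).
pose s v := coset N (xget 1 [set g | r g = v]%classic).
apply: (sub_finite_set _ (finite_image s (@finite_finset _ setT))) => _ [x _ <-].
exists (r x) => //; apply: rN.
exact: (@xgetPex _ 1 [set g | r g = r x]%classic (ex_intro _ x erefl)).
Qed.

(** The common kernel of all morphisms to [H] is open, so one [u] serves them all; this matters
    because the morphism it is applied to is built from [u]. *)
Lemma closure_finite_group (F : groupType) (a b : F) (H : finGroupType)
    (A : set F) (w : F) :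
  free_pair a b -> closure (A : set (profinite F)) w ->
  exists2 u, A u & forall f : F -> H, monoid.monoid_morphism f -> f u = f w.
Proof.
move=> ab Aw; have [nN fN] := kernels_finite_index H ab.
have [|u [Au /mem_coset Nu]] := Aw _ (open_nbhs_nbhs (conj (open_coset w nN fN) _)).
  by apply/mem_coset; rewrite mulVg; apply: normal_subgroup1.
exists u => // f fM; have := Nu f fM.
by rewrite (morph_mul fM) (morph_inv fM) => /mulg1_eq; rewrite invgK.
Qed.

Definition splitting (F : groupType) (T : eqType) (h : F -> T) (w : F) : Prop :=
  almost_invariant h /\ forall g, (h (g * w) == h g) = (g != 1).

(** * From the profinite closure to a splitting *)

Section Separation.
Variables (F : groupType) (a b : F) (ab : free_pair a b) (k : finFieldType).
Import GRing.Theory.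
Local Open Scope ring_scope.

Lemma closure_splitting (w : F) :
  closure ([set u | primitive u]%classic : set (profinite F)) w ->
  exists h : F -> k, splitting h w.
Proof.
move=> clw; have [y [L yw]] := path_exists ab w.
(* [mark c0] is the indicator of [1]; if it is a coboundary, the function [h] obtained splits
   [w]. *)
pose c0 : 'rV[k]_L.+1 := delta_mx 0 0.
have [[h hA hw]|nc0] := pselect (coboundary a b y c0).
  exists h; split=> // g; rewrite -subr_eq0 -yw hw /mark.
  rewrite (bigD1 ord0) //= big1 => [|i /negPf i0]; rewrite !mxE ?i0 ?mul0rn //.
  by rewrite !eqxx mulg1 addr0; case: (eqVneq g 1%g) => _; rewrite ?oner_eq0 ?eqxx.
have [rho [rhoM rhoP]] := representation_exists ab k y L.
pose v := relrow a b k y L 0.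
have v_neq0 : v != 0.
  apply/eqP => v0; apply: nc0; apply/relmxP; apply: etrans v0.
  rewrite /v /relrow rowE /c0. congr (delta_mx _ _ *m _).
  by apply: val_inj; rewrite /= inordK.
have [x vx] : exists x : 'cV_L.+1, v *m x != 0.
  have /existsP[j vj] : [exists j, v 0 j != 0].
    apply: contra_neqT v_neq0 => /existsPn v0; apply/rowP => j; rewrite [RHS]mxE.
    by apply/eqP; have := v0 j; rewrite negbK.
  exists (delta_mx j 0); apply: contraNneq vj => /matrixP/(_ 0 0).
  by rewrite -colE [LHS]mxE [RHS]mxE => ->.
have [u [B Bfree Bu] uw] := closure_finite_group (affine k L.+1) ab clw.
(* The lift of [rho] whose derivation is [x] at [u] and zero on the rest of the basis. *)
pose f g : affine k L.+1 := (rho g, if g == u then x else 0).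
have [Phi [[PhiM PhiB] _]] := Bfree _ f.
have Phi1 g : (Phi g).1 = rho g.
  have [psi [_ psiU]] := Bfree _ rho.
  rewrite -(psiU rho) // (psiU (fst \o Phi)) // => {g}; split=> [|g Bg] /=; last by rewrite PhiB.
  by split=> [|g g'] /=; rewrite ?(morph_one PhiM) ?(morph_mul PhiM).
pose d g : 'cV[k]_L.+1 := (Phi g).2.
have dM g g' : d (g * g')%g = d g + GLval (rho g) *m d g'.
  by rewrite /d (morph_mul PhiM) -Phi1.
have d1 : d 1%g = 0 by rewrite /d (morph_one PhiM).
have dw : d w = x by rewrite /d -uw // PhiB //= eqxx.
(* The derivation rule along the path: [rho] carries [v] to the class of each prefix, and an inverse
   letter contributes negatively at its source. Grouped by generator, the sum for [m = L] vanishes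
   by [edges_coboundary]. *)
have vd m : (m <= L)%N -> v *m d (pth a b y m) =
    \sum_(i < m) edge_sign k y i *: (relrow a b k y L (src y i) *m d (ev a b ((y i).1, false))).
  elim: m => [|m IH] mL; first by rewrite big_ord0 d1 mulmx0.
  rewrite big_ord_recr /= dM mulmxDr IH ?(ltnW mL) //; congr (_ + _).
  rewrite mulmxA rhoP ?(ltnW mL) // /edge_sign /src.
  case ym: (y m) => [c []]; rewrite ?scale1r //=.
  have eV : ev a b (c, true) = (ev a b (c, false))^-1%g by rewrite -ev_flip.
  have dV g : d g^-1%g = - (GLval (rho g^-1%g) *m d g).
    by apply/eqP; rewrite -addr_eq0 -dM mulVg d1.
  rewrite eV dV mulmxN mulmxA scaleN1r; congr (- (_ *m _)).
  by rewrite -(rhoP m.+1 mL) -(rhoP m (ltnW mL)) /= ym eV (morph_mul rhoM) GL_MxE mulmxA.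
case/eqP: vx; rewrite -dw -yw vd // (bigID (fun i : 'I_L => (y i).1)) /=.
have part q : \sum_(i < L | (y i).1 == q)
    edge_sign k y i *: (relrow a b k y L (src y i) *m d (ev a b ((y i).1, false))) = 0.
  under eq_bigr => i /eqP yq do rewrite yq scalemxAl.
  by rewrite -mulmx_suml (edges_coboundary ab); exact: mul0mx.
rewrite (eq_bigl _ _ (fun i : 'I_L => esym (eqb_id (y i).1))) part add0r.
by rewrite (eq_bigl _ _ (fun i : 'I_L => esym (eqbF_neg (y i).1))) part.
Qed.

End Separation.

(** * Nielsen moves *)

Section NielsenMoves.
Variable F : groupType.
Implicit Types a b g : F.

Lemma free_pair_swap a b : free_pair a b -> free_pair b a.
Proof.
move=> ab H x y; have [f [[fM [fa fb]] fU]] := ab H y x.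
by exists f; split=> // f' [f'M [f'b f'a]]; apply: fU.
Qed.

Lemma free_pair_inv a b : free_pair a b -> free_pair a^-1 b.
Proof.
move=> ab H x y; have [f [[fM [fa fb]] fU]] := ab H x^-1 y.
exists f; split=> [|f' [f'M [f'a f'b]]]; first by rewrite (morph_inv fM) fa invgK.
by apply: fU; split=> //; rewrite -f'a (morph_inv f'M) invgK.
Qed.

Lemma free_pair_mul a b : free_pair a b -> free_pair (a * b) b.
Proof.
move=> ab H x y; have [f [[fM [fa fb]] fU]] := ab H (x / y) y.
exists f; split=> [|f' [f'M [f'a f'b]]].
  by rewrite (morph_mul fM) fa fb mulgVK.
by apply: fU; split=> //; rewrite -f'a -f'b (morph_mul f'M) mulgK.
Qed.

Lemma free_pair_conj a b g : free_pair a b -> free_pair (a ^ g) (b ^ g).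
Proof.
move=> ab H x y.
have [f [[fM [fa fb]] fU]] := ab H x y.
exists (fun z => f (z ^ g^-1)); split=> [|f' [f'M [f'a f'b]]].
  rewrite !conjgK; split=> //; split=> [|u v]; first by rewrite conj1g (morph_one fM).
  by rewrite conjMg (morph_mul fM).
have -> : f = (fun z => f' (z ^ g)).
  apply: fU; split=> //; split=> [|u v]; first by rewrite conj1g (morph_one f'M).
  by rewrite conjMg (morph_mul f'M).
by apply/funext => z; rewrite conjgKV.
Qed.

Lemma free_pair_primitive a b x : free_pair a b -> primitive (ev a b x).
Proof.
have prim a' b' : free_pair a' b' -> primitive a'.
  move=> ab; exists [set a'; b']%classic; last by left.
  move=> H f; have [g [[gM [ga gb]] gU]] := ab H (f a') (f b').
  exists g; split=> [|g' [g'M g'B]]; first by split=> // _ [] ->.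
  by apply: gU; split=> //; split; apply: g'B; [left|right].
move=> ab; case: x => -[] []; rewrite /ev /=.
- exact: prim (free_pair_inv (free_pair_swap ab)).
- exact: prim (free_pair_swap ab).
- exact: prim (free_pair_inv ab).
- exact: prim ab.
Qed.

Definition nielsen a b (x z l : letter) : F :=
  if l == x then ev a b x * ev a b z
  else if l == flip x then (ev a b x * ev a b z)^-1 else ev a b l.

Lemma nielsen_free_pair a b x z : free_pair a b -> x.1 != z.1 ->
  exists a' b', free_pair a' b' /\ forall l, ev a' b' l = nielsen a b x z l.
Proof.
move=> ab xz.
exists (nielsen a b x z (false, false)), (nielsen a b x z (true, false)); split.
  (* The signs [e] and [f] are absorbed by inverting generators before and after [free_pair_mul]. *)
  have gen (c d : F) : free_pair c d -> forall e f : bool,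
      let g := (if e then c^-1 else c) * (if f then d^-1 else d) in
      free_pair (if e then g^-1 else g) d.
    move=> cd; have invr (u v : F) : free_pair u v -> free_pair u v^-1.
      by move=> uv; apply: free_pair_swap (free_pair_inv (free_pair_swap uv)).
    have mulr (u v : F) (f : bool) : free_pair u v -> free_pair (u * (if f then v^-1 else v)) v.
      case: f => uv; last exact: free_pair_mul.
      by rewrite -[v in free_pair _ v]invgK; apply: invr (free_pair_mul (invr _ _ uv)).
    by case=> f /=; [apply: free_pair_inv (mulr _ _ f (free_pair_inv cd))|apply: mulr].
  have ba := free_pair_swap ab.
  case: x z xz => -[] e [[] f] //= _.
    by apply: free_pair_swap; case: e (gen _ _ ba e f).
  by case: e (gen _ _ ab e f).
by case=> -[] []; case: x z xz => -[] [] [[] []] //= _; rewrite /nielsen /ev /= ?invgK.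
Qed.

Lemma free_pair_of_rank2 : free_of_rank 2 F -> exists a b, free_pair a b.
Proof.
case=> B Bfree /card_set_bijP[f [fB fI fS]].
have [a Ba fa] := fS 0 isT; have [b Bb fb] := fS 1%N isT.
have ba : (b == a) = false by apply/eqP => ba; rewrite ba fa in fb.
exists a, b => H x y.
have [g [[gM gB] gU]] := Bfree H (fun u => if u == a then x else y).
exists g; split=> [|g' [g'M [g'a g'b]]]; first by split=> //; rewrite !gB ?eqxx ?ba.
apply: gU; split=> // u Bu; have := fB u Bu; case fu: (f u) => [|[|]] //= _.
  by rewrite (fI u a) ?inE ?fu ?eqxx.
by rewrite (fI u b) ?inE ?fu ?ba.
Qed.

End NielsenMoves.

Lemma splitting_conj (F : groupType) (T : eqType) (h : F -> T) (w x : F) :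
  splitting h w -> exists h' : F -> T, splitting h' (w ^ x).
Proof.
move=> [hA hw]; exists (fun g => h (g ^ x^-1)); split=> [u|g].
  apply: (sub_finite_set _ (finite_image (fun g => g ^ x) (hA (u ^ x^-1)))) => g /=.
  by rewrite conjMg => ne; exists (g ^ x^-1); rewrite ?conjgKV.
by rewrite conjMg conjgK hw conjg_eq1.
Qed.

(** * Distance and backtracking in the tree *)

Section Length.
Variables (F : groupType) (a b : F) (ab : free_pair a b).

Lemma almost_invariant_far (T : eqType) (h : F -> T) : almost_invariant h ->
  exists N, forall g x, N <= size (nf ab g) -> h (g * ev a b x) = h g.
Proof.
move=> hA.
have far x : exists N, forall g, N <= size (nf ab g) -> h (g * ev a b x) = h g.
  have /finite_seqP[s hs] := hA (ev a b x).
  exists (\max_(g <- s) size (nf ab g)).+1 => g le_g; apply/eqP/negPn/negP => ne.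
  have sg : g \in s.
    by have : [set` s]%classic g by rewrite -hs.
  by move: le_g; rewrite ltnNge (leq_bigmax_seq _ sg).
have [N NP] := choice far.
exists (\max_(x : letter) N x) => g x le_g; apply: NP; apply: leq_trans le_g.
exact: leq_bigmax.
Qed.

Lemma pthD y m n : pth a b y (m + n) = pth a b y m * pth a b (fun i => y (m + i)) n.
Proof. by elim: n => [|n IH]; rewrite ?addn0 ?mulg1 // addnS /= IH mulgA. Qed.

Lemma pth_back y m i : m <= i ->
  pth a b y i * pth a b (fun j => flip (y (i.-1 - j))) m = pth a b y (i - m).
Proof.
elim: m => [|m IH] mi; first by rewrite mulg1 subn0.
rewrite /= mulgA IH ?(ltnW mi) // ev_flip.
have -> : i - m = (i - m.+1).+1 by lia.
by rewrite /= (_ : i.-1 - m = i - m.+1) ?mulgK //; lia.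
Qed.

(** Last letter first, as in [evr]: the vertex reached from [t] along [y] when nothing cancels. *)
Fixpoint trail (y : nat -> letter) (n : nat) (t : seq letter) : seq letter :=
  if n is m.+1 then y m :: trail y m t else t.

Lemma evr_trail y n t : evr a b (trail y n t) = evr a b t * pth a b y n.
Proof. by elim: n => [|n IH] /=; rewrite ?mulg1 // IH mulgA. Qed.

Lemma size_trail y n t : size (trail y n t) = n + size t.
Proof. by elim: n => //= n ->. Qed.

Lemma trail_first y n t : 0 < n -> exists r, trail y n t = r ++ y 0 :: t.
Proof.
elim: n => // -[_ _|n IH _]; first by exists [::].
by have [r /= rE] := IH isT; exists (y n.+1 :: r); rewrite /= rE.
Qed.

Lemma reduced_trail y n t : (forall i, y i.+1 != flip (y i)) ->
  reduced (y 0 :: t) -> reduced (trail y n t).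
Proof.
move=> yr rt; case: n => [|n]; first exact: reduced_behead rt.
elim: n => // n; rewrite /= => IH; rewrite reduced_cons IH andbT /=.
by apply: contraNneq (yr n) => -[->]; rewrite flipK.
Qed.

End Length.

(** * Connectivity of a cycle on the four letters *)

Section FourCycle.
Variables (T : Type) (f : letter -> T) (x0 x1 x2 x3 : letter).
Hypothesis Ux : uniq [:: x0; x1; x2; x3].

Lemma mem_four z : z \in [:: x0; x1; x2; x3].
Proof.
have [|_ ->] := uniq_min_size Ux (fun u _ => mem_enum {: bool * bool} u).
  by rewrite -cardE card_prod card_bool.
by rewrite mem_enum.
Qed.

(** A cycle without one vertex is a path, hence connected. *)
Lemma cycle_minus_vertex o :
  (x0 != o -> x1 != o -> f x0 = f x1) -> (x1 != o -> x2 != o -> f x1 = f x2) ->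
  (x2 != o -> x3 != o -> f x2 = f x3) -> (x3 != o -> x0 != o -> f x3 = f x0) ->
  forall u v, u != o -> v != o -> f u = f v.
Proof.
move: Ux; rewrite /= !inE !negb_or andbT => /and3P[/and3P[n01 n02 n03] /andP[n12 n13] n23].
have sym (u v : letter) : u != v -> v != u by rewrite eq_sym.
have [n10 n20 n30] := And3 (sym _ _ n01) (sym _ _ n02) (sym _ _ n03).
have [n21 n31 n32] := And3 (sym _ _ n12) (sym _ _ n13) (sym _ _ n23).
have := mem_four o; rewrite !inE => /or4P[] /eqP-> s01 s12 s23 s30.
all: try have e01 := s01 ltac:(assumption) ltac:(assumption).
all: try have e12 := s12 ltac:(assumption) ltac:(assumption).
all: try have e23 := s23 ltac:(assumption) ltac:(assumption).
all: try have e30 := s30 ltac:(assumption) ltac:(assumption).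
all: clear s01 s12 s23 s30 => u v; have := mem_four u; have := mem_four v.
all: rewrite !inE => /or4P[] /eqP-> /or4P[] /eqP-> //; rewrite ?eqxx // => _ _.
all: congruence.
Qed.

(** A cycle without one edge is connected; as the four letters are distinct, at most one edge is
    excepted. *)
Lemma cycle_minus_edge d e
    (exc := fun u v => (u = d /\ v = e) \/ (v = d /\ u = e)) :
  f x0 = f x1 \/ exc x0 x1 -> f x1 = f x2 \/ exc x1 x2 ->
  f x2 = f x3 \/ exc x2 x3 -> f x3 = f x0 \/ exc x3 x0 ->
  forall u v, f u = f v.
Proof.
move: Ux; rewrite /= !inE !negb_or andbT => /and3P[/and3P[n01 n02 n03] /andP[n12 n13] n23].
rewrite /exc => s01 s12 s23 s30.
have [e01 e12 e23] : [/\ f x0 = f x1, f x1 = f x2 & f x2 = f x3].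
  move: n01 n02 n03 n12 n13 n23 => /eqP n01 /eqP n02 /eqP n03 /eqP n12 /eqP n13 /eqP n23.
  by case: s01 => [s01|[[s01 s01']|[s01 s01']]];
    case: s12 => [s12|[[s12 s12']|[s12 s12']]];
    case: s23 => [s23|[[s23 s23']|[s23 s23']]];
    case: s30 => [s30|[[s30 s30']|[s30 s30']]]; split; congruence.
move=> u v; have := mem_four u; have := mem_four v.
by rewrite !inE => /or4P[] /eqP-> /or4P[] /eqP->; congruence.
Qed.

End FourCycle.

(** * Constancy of a splitting at infinity *)

Section Ends.
Variables (F : groupType) (a b : F) (ab : free_pair a b).
Variables (T : eqType) (h : F -> T) (N : nat).

(* [h] is constant on the branch of the tree behind [t], outside the ball of
   radius [N]. *)
Definition branch_const (t : seq letter) : Prop := forall r r',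
  reduced (r ++ t) -> reduced (r' ++ t) -> N <= size (r ++ t) ->
  N <= size (r' ++ t) -> h (evr a b (r ++ t)) = h (evr a b (r' ++ t)).

(** Following [x] straight on for [N] more steps stays reduced and leaves the ball. *)
Definition branch_val (t : seq letter) (x : letter) : T :=
  h (evr a b (nseq N x ++ x :: t)).

Lemma reduced_nseq x n t : reduced (x :: t) -> reduced (nseq n x ++ x :: t).
Proof.
move=> rt; elim: n => [|n IH] //=; rewrite reduced_cons IH andbT.
by case: n {IH} => [|n] /=; apply/eqP => -[/eqP]; rewrite flip_neq.
Qed.

Lemma branch_valE x t r : branch_const (x :: t) -> reduced (r ++ x :: t) ->
  N <= size (r ++ x :: t) -> h (evr a b (r ++ x :: t)) = branch_val t x.
Proof.
move=> xt rr Nr; apply: xt => //; last by rewrite size_cat size_nseq leq_addr.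
apply: reduced_nseq.
move: rr; rewrite /reduced /sorted; case: r {Nr} => [|z r] //=.
by rewrite cat_path => /and3P[].
Qed.

Variables (y : nat -> letter) (L : nat).
Hypotheses (L_gt0 : 0 < L) (yL : forall i, y (i + L) = y i).
Hypothesis y_red : forall i, y i.+1 != flip (y i).
Local Notation w := (pth a b y L).
Hypothesis hw : forall g, (h (g * w) == h g) = (g != 1).

Lemma shift_period i j : y (j * L + i) = y i.
Proof. by elim: j => [|j IH]; rewrite ?mul0n // mulSn -addnA addnC yL. Qed.

Lemma pth_period j : pth a b y (j * L) = w ^+ j.
Proof.
elim: j => [|j IH]; rewrite ?mul0n //= mulSn addnC pthD IH expgSr; congr (_ * _).
by apply: eq_pth => i _; rewrite shift_period.
Qed.

Lemma backward_reduced k j :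
  flip (y (k.-1 - j.+1)) != flip (flip (y (k.-1 - j))).
Proof.
rewrite flipK; case: (ltnP j k.-1) => jk.
  have -> : k.-1 - j = (k.-1 - j.+1).+1 by lia.
  by apply: contraNneq (y_red (k.-1 - j.+1)) => ->.
(* Past the start of the word the truncated index stays at [0], and a repeated letter is reduced. *)
have -> : k.-1 - j.+1 = k.-1 - j by lia.
by rewrite eq_sym flip_neq.
Qed.

(* The translate of the axis of [w] that passes through the vertex [t] at the
   position [i] of the periodic word leaves it by the branches [d] and [e]; it is
   the axis itself only if [t] is the root and [L] divides [i]. *)
Lemma ray t i (d := flip (y i.-1)) (e := y i) :
  branch_const (d :: t) -> branch_const (e :: t) ->
  0 < i -> N <= i -> reduced (d :: t) -> reduced (e :: t) ->
  (t != [::]) || ~~ (L %| i) -> branch_val t d = branch_val t e.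
Proof.
move=> cd ce i_gt0 Ni rd re nspecial.
(* [g] is position [0] of the translated axis, which passes through [t] at position [i]. *)
pose u := evr a b t; pose g := u * (pth a b y i)^-1.
have tE : t = nf ab u by rewrite evrK //; apply: reduced_behead rd.
pose zb k j := flip (y (k.-1 - j)).
have zb_red k j : zb k j.+1 != flip (zb k j) by exact: backward_reduced.
have zf_red k j : y (k + j.+1) != flip (y (k + j)) by rewrite addnS y_red.
have back : h g = branch_val t d.
  have gE : g = evr a b (trail (zb i) i t).
    rewrite evr_trail -/u; congr (_ * _); apply: (mulgI (pth a b y i)).
    by rewrite pth_back // subnn mulgV.
  have rg : reduced (trail (zb i) i t).
    by apply: reduced_trail => [|]; [apply: zb_red|rewrite /zb subn0].
  have Ng : N <= size (trail (zb i) i t) by rewrite size_trail; lia.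
  have [r rE] := trail_first (zb i) t i_gt0.
  rewrite gE rE in rg Ng *; rewrite /zb subn0 -/d in rg Ng *.
  exact: branch_valE.
(* Large enough for [g * w ^+ K] to lie more than [N] steps beyond [t]. *)
pose K := (i + N).+1.
have KL : i + N < K * L by rewrite /K; nia.
have forth : h (g * w ^+ K) = branch_val t e.
  pose zf j := y (i + j); pose m := K * L - i.
  have gE : g * w ^+ K = evr a b (trail zf m t).
    rewrite evr_trail -/u -mulgA -pth_period; congr (_ * _).
    by rewrite (_ : (K * L)%N = (i + m)%N) ?pthD ?mulKg // /m; lia.
  have rg : reduced (trail zf m t).
    by apply: reduced_trail => [j|]; [apply: zf_red|rewrite /zf addn0].
  have Ng : N <= size (trail zf m t) by rewrite size_trail /m; lia.
  have [|r rE] := trail_first zf t (_ : 0 < m); first by rewrite /m; lia.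
  rewrite gE rE in rg Ng *; rewrite /zf addn0 -/e in rg Ng *.
  exact: branch_valE.
(* If an orbit point were the root, the axis would lead from it to [t]: forwards, the last letter
   contradicts [rd]; backwards, it contradicts [re]; with no step at all, [t] is the root and [L]
   divides [i]. *)
have orbit_neq1 j : g * w ^+ j != 1.
  apply/eqP => gw1; have uE : u = (w ^+ j)^-1 * pth a b y i.
    by rewrite -(mulg1_eq gw1) invgK /g mulgVK.
  have {}uE : w ^+ j * u = pth a b y i by rewrite uE mulVKg.
  rewrite -pth_period in uE.
  have [ji|ij|ij] := ltngtP (j * L) i.
  - pose m := i - j * L; pose z l := y (j * L + l).
    have tz : t = trail z m [::].
      rewrite tE -[RHS](evrK ab); last by apply: reduced_trail => // l; apply: zf_red.
      congr (nf _ _); apply: (mulgI (pth a b y (j * L))); rewrite uE evr_trail mul1g -pthD.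
      by congr (pth _ _ _ _); rewrite /m; lia.
    move: rd; rewrite tz (_ : m = m.-1.+1) /=; last by rewrite /m; lia.
    rewrite reduced_cons /= /d /z flipK (_ : j * L + m.-1 = i.-1) ?eqxx //.
    by rewrite /m; lia.
  - pose m := j * L - i; pose z := zb (j * L)%N.
    have tz : t = trail z m [::].
      rewrite tE -[RHS](evrK ab); last by apply: reduced_trail => // l; apply: zb_red.
      congr (nf _ _); apply: (mulgI (pth a b y (j * L))); rewrite uE evr_trail mul1g.
      rewrite pth_back; last by rewrite /m; lia.
      by congr (pth _ _ _ _); rewrite /m; lia.
    move: re; rewrite tz (_ : m = m.-1.+1) /=; last by rewrite /m; lia.
    rewrite reduced_cons /= /e /z /zb (_ : (j * L).-1 - m.-1 = i) ?eqxx //.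
    by rewrite /m; lia.
  - move: nspecial; rewrite -ij dvdn_mull // orbF tE => /eqP; apply.
    apply/eqP; rewrite (nf_eq1 ab) -(inj_eq (mulgI (pth a b y i))) mulg1.
    by rewrite -{1}ij uE.
rewrite -back -forth; elim: {KL forth}K => [|j IH]; first by rewrite mulg1.
by rewrite expgSr mulgA IH; apply/esym/eqP; rewrite hw.
Qed.

Hypothesis far : forall g x, N <= size (nf ab g) -> h (g * ev a b x) = h g.

Lemma branch_const_far t : N <= size t -> branch_const t.
Proof.
move=> Nt; have to_t r : reduced (r ++ t) -> h (evr a b (r ++ t)) = h (evr a b t).
  elim: r => //= x r IH rr; have rr' := reduced_behead rr.
  by rewrite far ?IH // evrK // size_cat; apply: leq_trans Nt (leq_addl _ _).
by move=> r r' rr rr' _ _; rewrite !to_t.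
Qed.

(** As [t] is inside the ball, every vertex compared lies behind some [x :: t]. *)
Lemma branch_const_split t : size t < N ->
  (forall x, reduced (x :: t) -> branch_const (x :: t)) ->
  (forall x x', reduced (x :: t) -> reduced (x' :: t) ->
    branch_val t x = branch_val t x') -> branch_const t.
Proof.
move=> tN xt xx r r'; case/lastP: r => [|r x]; first by rewrite ltnNge in tN; rewrite (negPf tN).
case/lastP: r' => [|r' x']; first by rewrite ltnNge in tN; rewrite (negPf tN).
rewrite !cat_rcons => rr rr' Nr Nr'.
have red z s : reduced (s ++ z :: t) -> reduced (z :: t).
  by elim: s => //= u s IH /reduced_behead.
by rewrite !branch_valE ?(xx x x') //; (apply: xt || idtac); apply: red; eassumption.
Qed.

(* Edges of the Whitehead graph of the periodic word [y]. *)
Definition adjacent (d e : letter) : Prop := exists i,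
  (d = flip (y i) /\ e = y i.+1) \/ (e = flip (y i) /\ d = y i.+1).

Definition hamiltonian : Prop := exists x0 x1 x2 x3 : letter,
  [/\ uniq [:: x0; x1; x2; x3], adjacent x0 x1, adjacent x1 x2, adjacent x2 x3
    & adjacent x3 x0].

Lemma ray_adjacent t d e :
  (forall x, reduced (x :: t) -> branch_const (x :: t)) ->
  adjacent d e -> reduced (d :: t) -> reduced (e :: t) ->
  branch_val t d = branch_val t e \/
  t = [::] /\ ((d = flip (y L.-1) /\ e = y 0) \/ (e = flip (y L.-1) /\ d = y 0)).
Proof.
move=> xt [i de] rd re.
have base d' e' : reduced (d' :: t) -> reduced (e' :: t) ->
    d' = flip (y i) -> e' = y i.+1 -> branch_val t d' = branch_val t e' \/
    t = [::] /\ d' = flip (y L.-1) /\ e' = y 0.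
  move=> {de d e rd re} + + dE eE => rd re.
  have [/eqP t0|t_neq0] := boolP (t == [::]); last first.
    (* Adding [N] periods keeps the letters and makes the position at least [N]. *)
    left; have := @ray t (N * L + i).+1; rewrite /= -addnS !shift_period -dE -eE.
    apply=> //; try exact: xt; first by rewrite addnS.
      by rewrite (leq_trans (leq_pmulr N L_gt0)) ?leq_addr.
    by rewrite t_neq0.
  have [/dvdnP[m iL]|ndvd] := boolP (L %| i.+1); last first.
    left; have := @ray t (N * L + i).+1; rewrite /= -addnS !shift_period -dE -eE.
    apply=> //; try exact: xt; first by rewrite addnS.
      by rewrite (leq_trans (leq_pmulr N L_gt0)) ?leq_addr.
    by rewrite dvdn_addr ?ndvd ?orbT // dvdn_mull.
  right; split=> //; split; last by rewrite eE iL -[X in y X]addn0 shift_period.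
  case: m iL => // m iL; rewrite dE; congr flip.
  by rewrite -(shift_period L.-1 m); congr y; lia.
case: de => -[dE eE].
  by have [|[t0 de]] := base d e rd re dE eE; [left|right; split=> //; left].
by have [|[t0 de]] := base e d re rd dE eE; [left|right; split=> //; right].
Qed.

(** Away from the root only one direction leads back; the Hamiltonian cycle without it still
    connects the others. *)
Lemma branch_const_step t : hamiltonian -> t != [::] -> reduced t -> size t < N ->
  (forall x, reduced (x :: t) -> branch_const (x :: t)) -> branch_const t.
Proof.
move=> [x0 [x1 [x2 [x3 [Ux a01 a12 a23 a30]]]]] t0 rt tN xt.
have step d e : adjacent d e -> reduced (d :: t) -> reduced (e :: t) ->
    branch_val t d = branch_val t e.
  by move=> de rd re; have [|[/eqP]] := ray_adjacent xt de rd re; rewrite ?(negPf t0).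
apply: branch_const_split => // u v.
case: t t0 rt tN xt step => // o t _ rt _ _ step.
have out z : reduced (z :: o :: t) = (z != flip o).
  rewrite reduced_cons rt andbT /=; congr negb.
  by apply/eqP/eqP => [[->]|->]; rewrite flipK.
rewrite !out; move: u v.
by apply: (cycle_minus_vertex Ux) => *; apply: step; rewrite ?out.
Qed.

Lemma h_w_neq_h1 : h w <> h 1.
Proof. by move=> w1; have := hw 1; rewrite mul1g w1 !eqxx. Qed.

Lemma orbit_const g K : (forall j, j < K -> g * w ^+ j != 1) -> h (g * w ^+ K) = h g.
Proof.
elim: K => [|K IH] gK; first by rewrite mulg1.
rewrite expgSr mulgA -IH => [|j jK]; last by apply: gK; apply: ltnW.
by apply/eqP; rewrite hw gK.
Qed.

Lemma nf_expw m : nf ab (w ^+ m) = trail y (m * L) [::].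
Proof.
rewrite -pth_period -[RHS](evrK ab) ?evr_trail ?mul1g //.
exact: reduced_trail.
Qed.

Lemma expw_neq1 m : 0 < m -> w ^+ m != 1.
Proof.
move=> m_gt0; rewrite -(nf_eq1 ab) nf_expw -size_eq0 size_trail addn0.
by rewrite muln_eq0; lia.
Qed.

(** [h] jumps only at [1], to which positive powers never return. So the forward end of the axis
    carries [h w], and by [h_expwV] the backward end carries [h 1]. *)
Lemma h_expw n : h (w ^+ n.+1) = h w.
Proof. by rewrite expgS orbit_const // => j _; rewrite -expgS expw_neq1. Qed.

Lemma h_expwV n : h (w ^+ n)^-1 = h 1.
Proof.
rewrite -(mulVg (w ^+ n)) orbit_const // => j jn.
have := expw_neq1 (_ : 0 < n - j); rewrite subn_gt0 => /(_ jn).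
apply: contraNneq => /mulg1_eq; rewrite invgK => wnj.
by rewrite expgnFr ?(ltnW jn) // wnj mulgV.
Qed.

Lemma not_hamiltonian : ~ hamiltonian.
Proof.
move=> ham.
(* Descending induction on spheres; [m] bounds the depth remaining inside the ball. *)
have const t : t != [::] -> reduced t -> branch_const t.
  have [m Nm] : exists m, N <= m + size t by exists N; rewrite leq_addr.
  elim: m t Nm => [|m IH] t Nm t0 rt; first exact: branch_const_far.
  have [/branch_const_far//|tN] := leqP N (size t).
  by apply: branch_const_step => // x rx; apply: IH; rewrite //= addnS.
have const1 x : reduced (x :: [::]) -> branch_const (x :: [::]) by move=> _; apply: const.
(* At the root only the turn of the axis itself fails, which removes at most one edge of the
   cycle. *)
have const0 : branch_const [::].
  have [N0|N_gt0] := posnP N; first by apply: branch_const_far; rewrite N0.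
  apply: branch_const_split => // u v _ _; move: u v.
  case: ham => [x0 [x1 [x2 [x3 [Ux a01 a12 a23 a30]]]]].
  apply: (cycle_minus_edge (d := flip (y L.-1)) (e := y 0) Ux).
  - by case: (ray_adjacent const1 a01 isT isT) => [->|[_ ?]]; [left|right].
  - by case: (ray_adjacent const1 a12 isT isT) => [->|[_ ?]]; [left|right].
  - by case: (ray_adjacent const1 a23 isT isT) => [->|[_ ?]]; [left|right].
  - by case: (ray_adjacent const1 a30 isT isT) => [->|[_ ?]]; [left|right].
(* The powers of [w] with exponents [K] and [-K] lie outside the ball, at opposite ends of the
   axis. *)
pose K := N.+1; have NK : N <= K * L by rewrite /K; nia.
have [w1 wV1] := (h_expw N, h_expwV K).
apply: h_w_neq_h1; rewrite -w1 -wV1.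
pose zb j := flip (y ((K * L).-1 - j)).
have := const0 (trail y (K * L) [::]) (trail zb (K * L) [::]).
rewrite !cats0 !size_trail addn0 !evr_trail !mul1g pth_period.
have -> : pth a b zb (K * L) = (w ^+ K)^-1.
  by apply: (mulgI (w ^+ K)); rewrite -pth_period pth_back // subnn mulgV.
apply=> //; first exact: reduced_trail.
by apply: reduced_trail => // j; apply: backward_reduced.
Qed.

Lemma nf_exp_ev x m : nf ab (ev a b x ^+ m) = nseq m x.
Proof.
have rm : reduced (nseq m x).
  case: m => // m; have := reduced_nseq m (isT : reduced [:: x]).
  by rewrite -[X in _ ++ X]/(nseq 1 x) -nseqD addn1.
by rewrite -[RHS](evrK ab) //; congr (nf _ _); elim: {rm}m => // m IH; rewrite expgSr IH.
Qed.

(** Now [w] is a proper power of [X]. The orbit of [X] under [w] avoids [1] because [L > 1], and far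
    out it is adjacent to the axis at both ends; so [h w = h X = h 1]. *)
Lemma not_constant x : 1 < L -> ~ (forall i, y i = x).
Proof.
move=> L_gt1 yx; set X := ev a b x.
have wE : w = X ^+ L by elim: (L) => // n IH; rewrite /= IH yx expgSr.
have X_neq1 m : 0 < m -> X ^+ m != 1.
  by rewrite -(nf_eq1 ab) nf_exp_ev; case: m.
pose K := N.+1; have NK : N <= K * L by rewrite /K; nia.
have hX1 : h (w ^+ K) = h X.
  rewrite -(far x) ?nf_expw ?size_trail ?addn0 // -/X.
  rewrite wE -expgnA -expgSr expgS expgnA -wE orbit_const // => j _.
  by rewrite wE -expgnA -expgS X_neq1.
have hX2 : h (w ^+ K)^-1 = h X.
  rewrite -(far x); last first.
    have -> : (w ^+ K)^-1 = ev a b (flip x) ^+ (K * L).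
      by rewrite ev_flip expVgn wE -expgnA mulnC.
    by rewrite nf_exp_ev size_nseq.
  have wX : commute X w by rewrite wE; apply: commuteX.
  have -> : (w ^+ K)^-1 * X = X * (w ^+ K)^-1.
    by apply/esym/commuteV/commuteX.
  rewrite -[in RHS](mulgVK (w ^+ K) X) orbit_const // => j jK.
  rewrite -(subnKC (ltnW jK)) expgnDr invgM !mulgA mulgVK divg_eq1.
  have pos : 0 < (L * (K - j)).-1 by nia.
  apply: contraNneq (X_neq1 _ pos) => Xw; apply/eqP/(mulgI X).
  rewrite mulg1 -expgS prednK; last by nia.
  by rewrite expgnA -wE -Xw.
by apply: h_w_neq_h1; rewrite -(h_expw N) -(h_expwV K) hX1 hX2.
Qed.

End Ends.

(** * Turns of a word and the substitution of a Nielsen move *)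

Definition junction (d e u v : letter) : bool :=
  (flip u == d) && (v == e) || (flip u == e) && (v == d).

Lemma junctionC d e u v : junction d e u v = junction e d u v.
Proof. exact: orbC. Qed.

(** The turn from [u] to [v] is the edge from [flip u] to [v] of the Whitehead graph. It is not a
    loop, so an end at [d] is joined to one of the three other letters. *)
Lemma junction_degree d z u v : d.1 != z.1 -> v != flip u ->
  (flip u == d) + (v == d) =
  junction d (flip d) u v + junction d z u v + junction d (flip z) u v.
Proof.
by case: d z u v => -[] [] [[] []] [[] []] [[] []].
Qed.

(* The letter [l], rewritten for the basis where [x z] replaces [x]; the flags
   tell whether [z] is inserted at the junctions before and after [l]. *)
Definition block (x z : letter) (j0 : bool) (l : letter) (j1 : bool) : seq letter :=
  if l == x then (if j1 then [:: x] else [:: flip z; x])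
  else if l == flip x then (if j0 then [:: flip x] else [:: flip x; z])
  else if l == z then (if j0 then [::] else [:: z])
  else (if j1 then [::] else [:: flip z]).

Section Substitution.
Variables (x z : letter).
Hypothesis xz : x.1 != z.1.
Local Notation J := (junction (flip x) z).

Lemma size_block u l v :
  size (block x z (J u l) l (J l v)) + J u l + J l v = 1 + (l.1 == x.1).
Proof.
by case: x z u l v xz => -[] [] [[] []] [[] []] [[] []] [[] []] .
Qed.

(** The correcting factors cancel between neighbouring blocks, so the blocks of a cyclic word
    multiply to a conjugate of it. *)
Lemma evr_block (F : groupType) (a b a' b' : F) u l v :
  (forall l, ev a' b' l = nielsen a b x z l) ->
  evr a' b' (block x z (J u l) l (J l v)) =
  (if J u l then ev a b z else 1)^-1 * ev a b l * (if J l v then ev a b z else 1).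
Proof.
move=> evE.
have [ex efx] : ev a' b' x = ev a b x * ev a b z /\ 
    ev a' b' (flip x) = (ev a b z)^-1 * (ev a b x)^-1.
  by rewrite ev_flip evE /nielsen eqxx invgM.
have ez : ev a' b' z = ev a b z.
  by rewrite evE /nielsen; case: x z xz => -[] [] [[] []].
have := xz; have : [|| l == x, l == flip x, l == z | l == flip z].
  by case: x z l xz => -[] [] [[] []] [[] []].
case/or4P=> /eqP -> xz'.
- have -> : J u x = false by case: x z u xz' => -[] [] [[] []] [[] []].
  rewrite /block eqxx; case: ifP => _ /=; rewrite ?mul1g ex ?ev_flip ?ez ?invg1 ?mul1g ?mulg1 //.
  by rewrite mulgK.
- have -> : J (flip x) v = false by case: x z v xz' => -[] [] [[] []] [[] []].
  rewrite /block [flip x == x]eq_sym flip_neq eqxx.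
  case: ifP => _ /=; rewrite efx ?ez ?mul1g ?mulg1 ?ev_flip ?invg1 ?mul1g //.
  by rewrite mulVKg.
- have -> : J z v = false by case: x z v xz' => -[] [] [[] []] [[] []].
  rewrite /block; have -> : (z == x) = false by case: x z xz' => -[] [] [[] []].
  have -> : (z == flip x) = false by case: x z xz' => -[] [] [[] []].
  rewrite eqxx; case: ifP => _ /=; rewrite ?ez ?mul1g ?mulg1 ?invg1 ?mul1g ?mulVg //.
- have -> : J u (flip z) = false by case: x z u xz' => -[] [] [[] []] [[] []].
  rewrite /block; have -> : (flip z == x) = false by case: x z xz' => -[] [] [[] []].
  have -> : (flip z == flip x) = false by case: x z xz' => -[] [] [[] []].
  rewrite [flip z == z]eq_sym flip_neq.
  case: ifP => _ /=; rewrite ?ev_flip ?ez ?mul1g ?mulg1 ?invg1 ?mul1g ?mulVg //.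
Qed.

End Substitution.

(** The length is minimised over all bases, conjugates and words, reduced or not, so that cyclic
    reduction and Nielsen moves cannot shorten it. *)
Lemma minimal_word (F : groupType) (w : F) : (exists a b : F, free_pair a b) ->
  exists a b y L g, [/\ free_pair a b, pth a b y L = w ^ g,
    0 < L -> forall i, y (i + L) = y i &
    forall a' b' y' L' g', free_pair a' b' -> pth a' b' y' L' = w ^ g' -> L <= L'].
Proof.
move=> [a [b ab]].
pose P n := exists (a b : F) y g, free_pair a b /\ pth a b y n = w ^ g.
have exP : exists n, `[< P n >].
  have [y [L yL]] := path_exists ab w.
  by exists L; apply/asboolP; exists a, b, y, 1; rewrite conjg1.
case: (ex_minnP exP) => L /asboolP[a0 [b0 [y [g [ab0 yL]]]]] minL.
exists a0, b0, (fun i => y (i %% L)), L, g; split=> //.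
- by rewrite -yL; apply: eq_pth => i iL; rewrite modn_small.
- by move=> _ i; rewrite modnDr.
by move=> a' b' y' L' g' ab' yL'; apply: minL; apply/asboolP; exists a', b', y', g'.
Qed.

(** * The Whitehead graph of a minimal word *)

Section Whitehead.
Variables (F : groupType) (a b : F) (ab : free_pair a b).
Variables (y : nat -> letter) (L : nat).
Hypotheses (L_gt0 : 0 < L) (yL : forall i, y (i + L) = y i).
Local Notation w := (pth a b y L).
Hypothesis w_min : forall a' b' y' L' g, free_pair a' b' ->
  pth a' b' y' L' = w ^ g -> L <= L'.

Lemma rotation i : pth a b (fun j => y (i + j)) L = w ^ pth a b y i.
Proof.
apply: (mulgI (pth a b y i)); rewrite -pthD conjgE mulVKg addnC pthD.
by congr (_ * _); apply: eq_pth => j _; rewrite addnC yL.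
Qed.

(** Otherwise a rotation begins with a cancelling pair, and deleting it gives a conjugate of length
    [L - 2]. *)
Lemma cyclically_reduced i : y i.+1 != flip (y i).
Proof.
apply/eqP => yi.
have L_gt1 : 1 < L.
  rewrite ltn_neqAle L_gt0 andbT; apply/eqP => L1.
  by have /eqP := yL i; rewrite -L1 addn1 yi eq_sym flip_neq.
suff : L <= L - 2 by lia.
apply: (w_min (y' := fun j => y (i + (2 + j))) (g := pth a b y i) ab).
rewrite -rotation -{2}(subnKC L_gt1) pthD /= mul1g !addn0 addn1 yi ev_flip.
by rewrite mulgV mul1g.
Qed.

Lemma sum_rotation (f : nat -> nat) : f L = f 0 ->
  \sum_(i < L) f i.+1 = \sum_(i < L) f i.
Proof.
move=> fL; have fE : f 0 + \sum_(i < L) f i.+1 = \sum_(i < L) f i + f 0.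
  transitivity (\sum_(i < L.+1) f i); first by rewrite big_ord_recl.
  by rewrite big_ord_recr /= fL.
by apply: (@addnI (f 0)); rewrite fE addnC.
Qed.

Definition edges (d e : letter) : nat := \sum_(i < L) junction d e (y i) (y i.+1).
Definition letters (c : bool) : nat := \sum_(i < L) ((y i).1 == c).

Lemma edgesC d e : edges d e = edges e d.
Proof. by apply: eq_bigr => i _; rewrite junctionC. Qed.

Lemma y_period0 : y L = y 0.
Proof. by rewrite -[L]add0n yL. Qed.

(** The degree of [d]: an occurrence of [d] counts at the junction before it, one of [flip d] at the
    junction after it. *)
Lemma edges_degree d z : d.1 != z.1 ->
  letters d.1 = edges d (flip d) + edges d z + edges d (flip z).
Proof.
move=> dz; rewrite /edges -!big_split /=.
under [RHS]eq_bigr => i _ do rewrite -(junction_degree dz (cyclically_reduced i)).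
rewrite big_split (@sum_rotation (fun i => nat_of_bool (y i == d))) ?y_period0 // -big_split.
apply: eq_bigr => i _ /=.
by case: (y i) d {dz} => -[] [] [[] []].
Qed.

(** Replacing [x] by [x z] adds a letter for each occurrence of the generator of [x] and saves two
    for each edge between [flip x] and [z]; minimality forbids a net gain. *)
Lemma edges_minimal x z : x.1 != z.1 -> 2 * edges (flip x) z <= letters x.1.
Proof.
move=> xz; pose j i := junction (flip x) z (y i) (y i.+1).
have [a' [b' [ab' evE]]] := nielsen_free_pair ab xz.
pose c i := if j i then ev a b z else 1.
(* Starting from [y 1] gives the letter [y m'.+1] the junctions [m'] and [m'.+1]. *)
pose fix nw m := if m is m'.+1 then block x z (j m') (y m'.+1) (j m'.+1) ++ nw m' else [::].
have nwE m : evr a' b' (nw m) = (c 0)^-1 * pth a b (fun i => y (1 + i)) m * c m.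
  elim: m => [|m IH]; first by rewrite /= mulg1 mulVg.
  by rewrite /= evr_cat IH (evr_block xz _ _ _ evE) -/(c m) -/(c m.+1) !mulgA mulgK.
have nw_size m : size (nw m) + \sum_(i < m) j i + \sum_(i < m) j i.+1 =
    m + \sum_(i < m) ((y i.+1).1 == x.1).
  elim: m => [|m IH]; first by rewrite !big_ord0.
  have := size_block xz (y m) (y m.+1) (y m.+2); rewrite -/(j m) -/(j m.+1).
  rewrite !big_ord_recr /= size_cat; move: IH (size (block _ _ _ _ _)) => /=.
  move: (size (nw m)) (nat_of_bool (j m)) (nat_of_bool (j m.+1)) (nat_of_bool (_ == x.1)).
  by move: (\sum_(i < m) j i) (\sum_(i < m) j i.+1) (\sum_(i < m) _); lia.
have jL : j L = j 0 by rewrite /j y_period0 -[L.+1]add1n yL.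
have := nw_size L; rewrite (@sum_rotation (fun i => nat_of_bool (j i))) ?jL //.
rewrite (@sum_rotation (fun i => nat_of_bool ((y i).1 == x.1))) ?y_period0 // -/(letters x.1).
rewrite -/(edges (flip x) z).
have [y' y'E] := evr_pth a' b' (nw L).
suff : L <= size (nw L) by lia.
apply: (w_min (g := pth a b y 1 * c 0) ab' (y' := y')).
rewrite y'E nwE rotation conjgM [in RHS]conjgE /c jL.
by rewrite -[LHS]mulgA.
Qed.

Lemma edges_adjacent d e : 0 < edges d e -> adjacent y d e.
Proof.
rewrite lt0n sum_nat_eq0 => /forallPn[i]; rewrite /= eqb0 negbK => ji.
by exists i; case/orP: ji => /andP[/eqP-> /eqP->]; [left|right].
Qed.

(** Equal degrees of a letter and its inverse give [edges a0 b0 = edges A0 B0] and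
    [edges a0 B0 = edges A0 b0]. If just one of these numbers vanishes, minimality forces edges from
    [a0] to [A0] and from [b0] to [B0], which complete a cycle. *)
Lemma hamiltonian_or_constant : hamiltonian y \/ exists x, forall i, y i = x.
Proof.
pose a0 : letter := (false, false); pose A0 : letter := (false, true).
pose b0 : letter := (true, false); pose B0 : letter := (true, true).
have da : letters false = edges a0 A0 + edges a0 b0 + edges a0 B0 := @edges_degree a0 b0 isT.
have dA : letters false = edges A0 a0 + edges A0 b0 + edges A0 B0 := @edges_degree A0 b0 isT.
have db : letters true = edges b0 B0 + edges b0 a0 + edges b0 A0 := @edges_degree b0 a0 isT.
have dB : letters true = edges B0 b0 + edges B0 a0 + edges B0 A0 := @edges_degree B0 a0 isT.
have m1 : 2 * edges a0 b0 <= letters false := @edges_minimal A0 b0 isT.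
have m2 : 2 * edges a0 B0 <= letters false := @edges_minimal A0 B0 isT.
have m3 : 2 * edges b0 a0 <= letters true := @edges_minimal B0 a0 isT.
have m4 : 2 * edges B0 a0 <= letters true := @edges_minimal b0 a0 isT.
have := edgesC a0 A0; have := edgesC b0 B0; have := edgesC a0 b0.
have := edgesC a0 B0; have := edgesC A0 b0; have := edgesC A0 B0.
move=> c1 c2 c3 c4 c5 c6.
have [ab0|ab_gt0] := posnP (edges a0 b0); last first.
  have [aB0|aB_gt0] := posnP (edges a0 B0); last first.
    by left; exists a0, b0, A0, B0; split=> //; apply: edges_adjacent; lia.
  by left; exists a0, A0, B0, b0; split=> //; apply: edges_adjacent; lia.
have [aB0|aB_gt0] := posnP (edges a0 B0); last first.
  by left; exists a0, A0, b0, B0; split=> //; apply: edges_adjacent; lia.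
(* No edge joins the two generators, so only one occurs, and reducedness fixes its sign. *)
right; exists (y 0).
have no_edge d e : d.1 != e.1 -> edges d e = 0.
  by case: d e => -[] [] [[] []] //= _; rewrite -/a0 -/A0 -/b0 -/B0; lia.
have same_gen i : (y i.+1).1 = (y i).1.
  apply/eqP/negPn/negP => ne; rewrite eq_sym in ne.
  have := no_edge (flip (y i)) (y i.+1) ne.
  have -> : y i.+1 = y (i %% L).+1.
    by rewrite {1}(divn_eq i L) -addnS shift_period.
  have -> : y i = y (i %% L) by rewrite {1}(divn_eq i L) shift_period.
  move/eqP; rewrite sum_nat_eq0 => /forallP/(_ (Ordinal (ltn_pmod i L_gt0))).
  by rewrite /= /junction !eqxx.
have step i : y i.+1 = y i.
  have := same_gen i; have := cyclically_reduced i.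
  by case: (y i) (y i.+1) => -[] [] [[] []].
by elim=> // i IH; rewrite step.
Qed.

End Whitehead.

(** * Primitivity of split elements and the closedness theorem *)

Lemma splitting_primitive (F : groupType) (T : eqType) (h : F -> T) (w : F) :
  (exists a b : F, free_pair a b) -> splitting h w -> primitive w.
Proof.
move=> rk2 hw.
have [a [b [y [L [g [ab wE yL w_min]]]]]] := minimal_word w rk2.
have [h' [h'A h'w]] := splitting_conj g hw; rewrite -wE in h'w.
case: L => [|[|L]] in wE yL w_min h'w *.
- by have := h'w 1; rewrite mulg1 !eqxx.
(* Length one: [w] is a letter of the conjugated basis. *)
- have -> : w = ev (a ^ g^-1) (b ^ g^-1) (y 0).
    have -> : ev (a ^ g^-1) (b ^ g^-1) (y 0) = ev a b (y 0) ^ g^-1.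
      by case: (y 0) => -[] []; rewrite /ev /= ?conjVg.
    by apply: (conjg_inj g); rewrite conjgKV -wE /= mul1g.
  exact/free_pair_primitive/free_pair_conj.
have {}w_min a' b' y' L' g' : free_pair a' b' ->
    pth a' b' y' L' = pth a b y L.+2 ^ g' -> L.+2 <= L'.
  by move=> ab' wE'; apply: (w_min a' b' y' L' (g * g')); rewrite // conjgM -wE.
have {}yL := yL isT.
have yr := cyclically_reduced ab (ltn0Sn _) yL w_min.
have [N far] := almost_invariant_far ab h'A.
case: (hamiltonian_or_constant ab (ltn0Sn _) yL w_min) => [|[x yx]].
  by move=> ham; case: (@not_hamiltonian _ _ _ ab _ h' N y L.+2 (ltn0Sn _) yL yr h'w far ham).
by case: (@not_constant _ _ _ ab _ h' N y L.+2 (ltn0Sn _) yL yr h'w far x isT yx).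
Qed.

Theorem corollary1p6 (F2 : groupType) (hF2 : free_of_rank 2 F2) :
  closed ([set x : F2 | primitive x]%classic : set (profinite F2)).
Proof.
have [a [b ab]] := free_pair_of_rank2 hF2.
apply/closure_id/seteqP; split; first exact: subset_closure.
move=> w /(closure_splitting ab 'F_2)[h hw].
by apply: splitting_primitive hw; exists a, b.
Qed.
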